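(* There exist absolute constants $C>0$ and $c>0$ such that for every prime power $q$ and every set $A\subset M_2(\mathbb{F}_q)$ with $|A|\ge C\,q^3$, \[\max\{|A+A|,\ |AA|\}\ \ge\ c\,\min\left\{\frac{|A|^2}{q^{7/2}},\ q^2|A|^{1/2}\right\},\] where $A+A=\{a+b: a,b\in A\}$ and $AA=\{ab: a,b\in A\}$.
   Context: $\mathbb{F}_q$ is the finite field with $q$ elements and $M_2(\mathbb{F}_q)$ is the ring of $2\times 2$ matrices over $\mathbb{F}_q$. *)

(* Defs.v *)
From HB Require Import structures.
From mathcomp Require Import all_boot all_order all_algebra.
From mathcomp Require Import reals exp.

Set Implicit Arguments.
Unset Strict Implicit.
Unset Printing Implicit Defensive.

Import Order.TTheory GRing.Theory Num.Theory.
Local Open Scope ring_scope.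

Definition sumset (F : finFieldType) (n : nat) (A B : {set 'M[F]_n}) :
    {set 'M[F]_n} :=
  [set a + b | a in A, b in B].

Definition prodset (F : finFieldType) (n : nat) (A B : {set 'M[F]_n}) :
    {set 'M[F]_n} :=
  [set a *m b | a in A, b in B].

(* Main.v *)
(** Count incidences between the points [(s, p)] of [(A + A) * (A A)] and the
    lines [s c = p + d]. Each line [(c, b c)] with [b, c] in [A] contains the
    [#|A|] points [(a + b, a c)]. Two points whose first coordinates differ by
    an invertible matrix lie on exactly one common line, and there are only
    [O(q^3)] singular matrices, so the number of points on a random line has
    small variance; by Chebyshev few lines can be that rich, unless [#|A|] is
    comparable to the average number of points on a line. *)
Require Import Defs.
From HB Require Import structures.
From mathcomp Require Import all_boot all_order all_algebra.
From mathcomp Require Import reals exp.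
From mathcomp Require Import ring lra zify.

Set Implicit Arguments.
Unset Strict Implicit.
Unset Printing Implicit Defensive.

Import Order.TTheory GRing.Theory Num.Theory.
Local Open Scope ring_scope.

Section Incidences.
Variables (F : finFieldType) (n : nat).
Local Notation M := 'M[F]_n.
Implicit Types (x y l : M * M) (P L : {set M * M}).

Definition incident x l := x.1 *m l.1 == x.2 + l.2.

Definition line_degree P l := #|[set x in P | incident x l]|.

Definition singular_mx : {set M} := [set a | a \notin unitmx].

Lemma line_degreeE P l : line_degree P l = (\sum_(x in P) incident x l)%N.
Proof.
rewrite /line_degree -sum1_card big_mkcond [RHS]big_mkcond /=.
by apply: eq_bigr => x _; rewrite inE; case: (x \in P); case: incident.
Qed.

(** Once the slope [c] is chosen, the incidence equation forces [d = x.1 c - x.2], so the lines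
    through a point are parametrised by their slopes. *)
Lemma sum_incident x (p : pred (M * M)) :
  (\sum_l incident x l * p l)%N = (\sum_(c : M) p (c, (x.1 *m c - x.2)%R))%N.
Proof.
rewrite (eq_bigr (fun l => incident x (l.1, l.2) * p (l.1, l.2)))%N; last by case.
rewrite -(pair_bigA _ (fun c d => incident x (c, d) * p (c, d)))%N /=.
apply: eq_bigr => c _; rewrite (bigD1 (x.1 *m c - x.2)) //= big1 => [|d].
  by rewrite /incident /= addrC subrK eqxx mul1n addn0.
rewrite /incident /= => nd; case: eqP => //= e.
by rewrite e addrC addKr eqxx in nd.
Qed.

Lemma sum_line_degree P : (\sum_l line_degree P l)%N = (#|P| * #|{: M}|)%N.
Proof.
under eq_bigr do rewrite line_degreeE.
rewrite exchange_big -sum_nat_const; apply: eq_bigr => x _.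
under eq_bigr do rewrite -[nat_of_bool _]muln1.
by rewrite (sum_incident x predT) sum1_card.
Qed.

(** Subtracting the two incidence equations eliminates [d]; what remains is one linear equation for
    the slope [c]. *)
Lemma common_lines x y :
  (\sum_l incident x l * incident y l)%N =
  #|[set c | (x.1 - y.1) *m c == x.2 - y.2]|.
Proof.
rewrite (sum_incident x (incident y)) -sum1_card big_mkcond [RHS]big_mkcond.
apply: eq_bigr => c _; rewrite inE /incident /= mulmxBl.
suff -> : (y.1 *m c == y.2 + (x.1 *m c - x.2)) =
          (x.1 *m c - y.1 *m c == x.2 - y.2) by case: eqP.
rewrite -subr_eq0 -[RHS]subr_eq0 -oppr_eq0; congr (_ == 0).
by rewrite !opprB [RHS]addrACA addrA [y.2 + (_ - _)]addrA [y.2 + _]addrC [LHS]addrAC.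
Qed.

Lemma common_lines_unit x y :
  x.1 - y.1 \in unitmx -> (\sum_l incident x l * incident y l <= 1)%N.
Proof.
move=> u; rewrite common_lines.
rewrite (leq_trans _ (eq_leq (cards1 (invmx (x.1 - y.1) *m (x.2 - y.2))))) //.
by apply/subset_leq_card/subsetP => c; rewrite !inE => /eqP<-; rewrite mulKmx.
Qed.

(** Group the points [y] by their first coordinate [a], with [x.1 - a] singular. For each such [a]
    and each slope [c], only [y.2 = x.2 - (x.1 - a) c] contributes. *)
Lemma common_lines_singular x :
  (\sum_(y : M * M | (x.1 - y.1)%R \notin unitmx) \sum_l incident x l * incident y l
     <= #|singular_mx| * #|{: M}|)%N.
Proof.
under eq_bigr do rewrite common_lines -sum1_card big_mkcond /=.
rewrite (eq_bigl (fun y => (x.1 - y.1 \notin unitmx) && true));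
  last by move=> y; rewrite andbT.
rewrite -(pair_big_dep (fun s : M => x.1 - s \notin unitmx) (fun _ _ => true)
  (fun s (t : M) => \sum_(c : M)
    if c \in [set c | ((x.1 - s) *m c == x.2 - t)%R] then 1 else 0)%N) /=.
have -> : #|singular_mx| = #|[set a | x.1 - a \notin unitmx]|.
  rewrite -(card_imset _ (can_inj (subKr x.1))); apply: eq_card => a.
  rewrite !inE; apply/imsetP/idP => [[b]|u].
    by rewrite inE => u ->; rewrite subKr.
  by exists (x.1 - a); rewrite ?inE // subKr.
rewrite -sum_nat_const [leqRHS](eq_bigl (fun a => x.1 - a \notin unitmx));
  last by move=> a; rewrite inE.
apply: leq_sum => a _; rewrite exchange_big -sum1_card /=.
apply: leq_sum => c _; rewrite (bigD1 (x.2 - (x.1 - a) *m c)) //= big1 => [|d].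
  by case: ifP.
by rewrite inE => /eqP nd; case: eqP => // e; case: nd; rewrite e subKr.
Qed.

(** The second moment counts pairs of points weighted by their number of common lines. Pairs with
    invertible difference of first coordinates give the [#|P| ^ 2] term, the others the error
    term. *)
Lemma sum_sqr_line_degree P :
  (\sum_l line_degree P l ^ 2 <= #|P| ^ 2 + #|P| * (#|singular_mx| * #|{: M}|))%N.
Proof.
have -> : (\sum_l line_degree P l ^ 2 =
  \sum_(x in P) \sum_(y in P) \sum_l incident x l * incident y l)%N.
  under eq_bigr do rewrite line_degreeE -mulnn big_distrlr /=.
  rewrite exchange_big; apply: eq_bigr => x _.
  by rewrite exchange_big.
rewrite -mulnn -mulnDr -sum_nat_const; apply: leq_sum => x _.
rewrite (bigID (fun y => x.1 - y.1 \in unitmx)) /= leq_add //.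
  rewrite -sum1_card [leqRHS](bigID (fun y => x.1 - y.1 \in unitmx)) /=.
  by rewrite (leq_trans _ (leq_addr _ _)) // leq_sum // => y /andP[_];
     apply: common_lines_unit.
apply: leq_trans (common_lines_singular x).
rewrite big_mkcond [leqRHS]big_mkcond /= leq_sum // => y _.
by case: (y \in P) => //=; case: ifP.
Qed.

(** Chebyshev's inequality, with deviations from the mean [#|P| / #|M|] scaled by [#|M|] to avoid
    division. The second hypothesis puts [k] at or above the mean, so that squaring preserves the
    order. *)
Lemma rich_lines (R : realFieldType) P L (k : nat) :
  (forall l, l \in L -> k <= line_degree P l)%N ->
  (#|P| <= k * #|{: M}|)%N ->
  #|L|%:R * (k%:R * #|{: M}|%:R - #|P|%:R) ^+ 2
    <= #|P|%:R * #|singular_mx|%:R * #|{: M}|%:R ^+ 3 :> R.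
Proof.
move=> rich le_k; set m : R := #|{: M}|%:R; set p : R := #|P|%:R.
pose f l : R := ((line_degree P l)%:R * m - p) ^+ 2.
have f_sum : \sum_l f l = m ^+ 2 * (\sum_l line_degree P l ^ 2)%:R - m ^+ 2 * p ^+ 2.
  have -> : \sum_l f l = \sum_l (m ^+ 2 * (line_degree P l ^ 2)%:R
      - 2 * m * p * (line_degree P l)%:R + p ^+ 2).
    by apply: eq_bigr => l _; rewrite /f natrX; ring.
  rewrite big_split sumrB /= -!mulr_sumr -!natr_sum sum_line_degree.
  rewrite sumr_const card_prod -mulr_natr !natrM -/m -/p; ring.
have sq_le : (\sum_l line_degree P l ^ 2)%:R <=
    p ^+ 2 + p * (#|singular_mx|%:R * m) :> R.
  by rewrite -natrX -!natrM -natrD ler_nat sum_sqr_line_degree.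
apply: (@le_trans _ _ (\sum_(l in L) f l)).
  rewrite mulr_natl -sumr_const ler_sum // => l /rich lk.
  have kp : p <= k%:R * m by rewrite -natrM ler_nat.
  rewrite ler_sqr ?nnegrE ?subr_ge0 ?lerD2r ?ler_wpM2r ?ler_nat //.
  by rewrite (le_trans kp) // ler_wpM2r ?ler_nat.
apply: (@le_trans _ _ (\sum_l f l)).
  rewrite [leRHS](bigID (mem L)) /= lerDl sumr_ge0 // => l _.
  exact: sqr_ge0.
(* The main terms [m ^+ 2 * p ^+ 2] cancel, leaving only the contribution of singular
   differences. *)
rewrite f_sum; have := ler_wpM2l (sqr_ge0 m) sq_le; lra.
Qed.

Lemma sumset_prodset_lines (A : {set M}) b c :
  b \in A -> c \in A ->
  (#|A| <= line_degree (setX (sumset A A) (prodset A A)) (c, b *m c))%N.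
Proof.
move=> bA cA; rewrite /line_degree.
rewrite -(card_imset _ (_ : injective (fun a => (a + b, a *m c)))); last first.
  by move=> a a' [/addIr].
apply/subset_leq_card/subsetP => _ /imsetP[a aA ->].
by rewrite !inE /incident /= mulmxDl eqxx andbT !imset2_f.
Qed.

End Incidences.

Lemma card_singular_mx2 (F : finFieldType) :
  (#|singular_mx F 2| <= 2 * #|F| ^ 3)%N.
Proof.
have q_gt1 : (1 < #|F|)%N := card_finNzRing_gt1 F.
have card_unit : #|[set a : 'M[F]_2 | a \in unitmx]| =
    (#|F| * #|F|.-1 ^ 2 * #|F|.+1)%N.
  rewrite -card_GL_2 -[RHS](card_imset _ val_inj); apply: eq_card => a.
  rewrite !inE; apply/idP/imsetP => [u|[g _ ->]]; last exact: (valP g).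
  by exists (Sub a u : {'GL_2[F]}).
have := cardsC [set a : 'M[F]_2 | a \in unitmx].
have -> : ~: [set a : 'M[F]_2 | a \in unitmx] = singular_mx F 2.
  by apply/setP => a; rewrite !inE.
rewrite card_unit card_mx -[(2 * 2)%N]/4%N; case: #|F| q_gt1 => // q _ eq_card.
(* With [Q = q.+1] the field size, this subtraction-free identity says that there are exactly
   [Q^3 + Q^2 - Q] singular matrices. *)
have e : (q.+1 * q ^ 2 * q.+2 + q.+1 ^ 3 + q.+1 ^ 2 = q.+1 ^ 4 + q.+1)%N.
  by rewrite -(addn2 q) -(addn1 q); ring.
have := leq_pexp2l (ltn0Sn q) (isT : 2 <= 3)%N; move: eq_card e.
move: (q.+1 * _ * _)%N (q.+1 ^ 2)%N (q.+1 ^ 3)%N (q.+1 ^ 4)%N #|singular_mx _ _|.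
move=> *; lia.
Qed.

Theorem theorem1p16 (R : realType) :
  exists C c : R,
    0 < C /\ 0 < c /\
    forall (F : finFieldType) (A : {set 'M[F]_2}),
      let q : R := #|F|%:R in
      C * q ^+ 3 <= #|A|%:R ->
      c * Num.min (#|A|%:R ^+ 2 / q `^ (7 / 2)) (q ^+ 2 * #|A|%:R `^ (1 / 2))
        <= (maxn #|sumset A A| #|prodset A A|)%:R.
Proof.
(* [C = 4] makes the at most [2 q^3] singular matrices no more than half of [A]; [c = 1 / 4] is the
   square root of the final constant [1 / 16]. *)
exists 4, (1 / 4); split; first lra; split; first lra.
move=> F A q A_ge; set N : R := #|A|%:R in A_ge *.
set K := maxn _ _; set P := setX (sumset A A) (prodset A A).
have q_gt0 : 0 < q by rewrite ltr0n ltnW ?card_finNzRing_gt1.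
have N_gt0 : 0 < N by apply: lt_le_trans A_ge; rewrite mulr_gt0 ?exprn_gt0.
have P_le : #|P|%:R <= K%:R ^+ 2 :> R.
  by rewrite -natrX ler_nat cardsX -mulnn leq_mul ?leq_maxl ?leq_maxr.
have mE : #|{: 'M[F]_2}|%:R = q ^+ 4 :> R by rewrite card_mx natrX.
have K_ge0 : 0 <= K%:R :> R by [].
(* If [K^2 / q^4], an upper bound for the mean number of points on a line, is at least [N / 2], the
   second term of the minimum follows at once. Otherwise lines with [N] points have more than twice
   the mean. *)
have [K_big|K_small] := lerP (q ^+ 4 * N) (2 * K%:R ^+ 2).
  apply: (@le_trans _ _ (1 / 4 * (q ^+ 2 * N `^ (1 / 2)))).
    by rewrite ler_wpM2l ?ge_min ?lexx ?orbT //; lra.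
  have r_ge0 := powR_ge0 N (1 / 2); set r := N `^ (1 / 2) in r_ge0 *.
  have rE : r ^+ 2 = N.
    by rewrite -powR_mulrn // -powRrM mul1r mulVf ?powRr1 ?ltW // pnatr_eq0.
  rewrite -ler_sqr ?nnegrE ?mulr_ge0 ?sqr_ge0 ?invr_ge0 //.
  by move: K_big (sqr_ge0 K%:R : 0 <= _ :> R); rewrite !exprMn rE; lra.
(* Invertibility of [c] lets [b] be recovered from [(c, b c)], so distinct pairs give distinct
   lines. *)
pose B := A :&: [set c | c \in unitmx].
pose L := [set (bc.2, bc.1 *m bc.2) | bc in setX A B].
have L_card : #|L| = (#|A| * #|B|)%N.
  rewrite card_in_imset ?cardsX // => -[b c] [b' c'].
  rewrite !inE /= => /andP[_ /andP[_ u]] _ [<-].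
  by move/(can_inj (mulmxK u)) ->.
have B_card : N <= 2 * #|B|%:R.
  have : (#|A| <= #|B| + #|singular_mx F 2|)%N.
    rewrite -(cardsID [set c | c \in unitmx] A) leq_add2l subset_leq_card //.
    by apply/subsetP => a; rewrite !inE => /andP[].
  have := card_singular_mx2 F; rewrite -2!(ler_nat R) natrM natrD natrX -/q -/N.
  by move: A_ge; lra.
have rich l : l \in L -> (#|A| <= line_degree P l)%N.
  case/imsetP => -[b c]; rewrite !inE => /and3P[bA cA _] -> /=.
  exact: sumset_prodset_lines.
have P_small : #|P|%:R <= N * q ^+ 4 / 2 by lra.
have /(rich_lines R rich) : (#|P| <= #|A| * #|{: 'M[F]_2}|)%N.
  rewrite -(ler_nat R) natrM mE -/N (le_trans P_small) // ler_pdivrMr //.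
  by have := mulr_gt0 N_gt0 (exprn_gt0 4 q_gt0); lra.
rewrite L_card natrM mE -/N => incid.
apply: (@le_trans _ _ (1 / 4 * (N ^+ 2 / q `^ (7 / 2)))).
  by rewrite ler_wpM2l ?ge_min ?lexx //; lra.
have s_gt0 := powR_gt0 (7 / 2) q_gt0; set s := q `^ (7 / 2) in s_gt0 *.
have sE : s ^+ 2 = q ^+ 7.
  by rewrite -powR_mulrn ?ltW // -powRrM divfK ?pnatr_eq0 // powR_mulrn ?ltW.
have s_ge0 := ltW s_gt0; rewrite mulrA ler_pdivrMr //.
rewrite -ler_sqr ?nnegrE ?mulr_ge0 ?sqr_ge0 ?invr_ge0 //.
rewrite !exprMn sE.
have sing_le : #|singular_mx F 2|%:R <= 2 * q ^+ 3 :> R.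
  by rewrite -natrX -natrM ler_nat card_singular_mx2.
(* The factor 8 is 4 from squaring the halved deviation ([h1]) times 2 from [#|B| >= N / 2]
   ([h2]). *)
have low : N ^+ 4 * q ^+ 8 <= 8 * (N * #|B|%:R * (N * q ^+ 4 - #|P|%:R) ^+ 2).
  have Nq_ge0 : 0 <= N * q ^+ 4 by rewrite mulr_ge0 ?exprn_ge0 ?ltW.
  have h1 : (N * q ^+ 4 / 2) ^+ 2 <= (N * q ^+ 4 - #|P|%:R) ^+ 2.
    by rewrite ler_sqr ?nnegrE; lra.
  have h2 : N * N <= 2 * (N * #|B|%:R).
    by have := ler_wpM2l (ltW N_gt0) B_card; lra.
  have := ler_pM (mulr_ge0 (ltW N_gt0) (ltW N_gt0)) (sqr_ge0 _) h2 h1; lra.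
have upp : #|P|%:R * #|singular_mx F 2|%:R * (q ^+ 4) ^+ 3
    <= K%:R ^+ 2 * (2 * q ^+ 3) * (q ^+ 4) ^+ 3.
  by rewrite ler_wpM2r ?ler_pM // -exprM exprn_ge0 ?(ltW q_gt0).
have q8 : 0 < q ^+ 8 by rewrite exprn_gt0.
(* Chaining [low], [incid] and [upp] gives [N^4 q^8 <= 16 K^2 q^15]; it remains to cancel [q^8]. *)
suff : N ^+ 4 / 16 <= K%:R ^+ 2 * q ^+ 7 by lra.
rewrite -(ler_pM2r q8); move: incid low upp.
set X := N * _ * _; set Y := #|P|%:R * _ * _; lra.
Qed.
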